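(* Every finitely generated strong sandwich group is nilpotent.
   Context: For group elements $x,g$ write $x^g=g^{-1}xg$. Let $G$ be a group and $X\subseteq G$ a subset. $X$ is called a strong sandwich set if: (1) $\langle a,b^{g}\rangle$ is nilpotent of class at most $2$ for all $a,b\in X$ and all $g\in\langle X\rangle$; and (2) $\langle a,b^{f},c^{g}\rangle$ is nilpotent of class at most $3$ for all $a,b,c\in X$ and all $f,g\in\langle X\rangle$. (The elements $a,b,c$ are not required to be distinct.) A group $G$ is called a strong sandwich group if $G=\langle X\rangle$ for some strong sandwich set $X$ in $G$. *)

(* Defs.v *)
From mathcomp Require Import all_boot.
From mathcomp Require Import boolp classical_sets cardinality.

Set Implicit Arguments.
Unset Strict Implicit.
Unset Printing Implicit Defensive.

Local Open Scope group_scope.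
Local Open Scope classical_set_scope.

(* [groupType] covers infinite groups. The [choiceType] structure it contains
   is no restriction: classically, every type carries one. *)

Definition generated (G : groupType) (X : set G) : set G :=
  smallest (fun H : set G => group_closed (mem H)) X.

Definition commutator_subgroup (G : groupType) (H K : set G) : set G :=
  generated [set [~ x, y] | x in H & y in K].

(* With the usual numbering gamma_1(H) = H, gamma_(i+1)(H) = [gamma_i(H), H],
   this is gamma_(n+1)(H). *)
Definition lower_central (G : groupType) (n : nat) (H : set G) : set G :=
  iter n (fun K => commutator_subgroup K H) H.

Definition nilpotent_class_le (G : groupType) (c : nat) (H : set G) : Prop :=
  lower_central c H = [set 1].

Definition nilpotent (G : groupType) (H : set G) : Prop :=
  exists c, nilpotent_class_le c H.

Definition finitely_generated (G : groupType) : Prop :=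
  exists Y : set G, finite_set Y /\ generated Y = [set: G].

Definition strong_sandwich_set (G : groupType) (X : set G) : Prop :=
  (forall a b g : G, X a -> X b -> generated X g ->
     nilpotent_class_le 2 (generated [set a; b ^ g])) /\
  (forall a b c f g : G, X a -> X b -> X c ->
     generated X f -> generated X g ->
     nilpotent_class_le 3 (generated [set a; b ^ f; c ^ g])).

Definition strong_sandwich_group (G : groupType) : Prop :=
  exists X : set G, strong_sandwich_set X /\ generated X = [set: G].

(* Main.v *)
Require Import Defs.
From mathcomp Require Import all_boot classical_sets.
From mathcomp Require Import boolp cardinality zify.

Set Implicit Arguments.
Unset Strict Implicit.
Unset Printing Implicit Defensive.

(** A finitely generated strong sandwich group is generated by finitely many
    elements [x_0, ..., x_(r-1)] of a set [S] that is closed under conjugation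
    and inversion and in which any two elements generate a group of class at
    most 2 and any three a group of class at most 3. For such a set these
    conditions amount to a few commutation rules, and the rules survive when the
    commutators of elements of [S] are added ([strong_add_brackets]). So [S] may
    be taken closed under commutators.

    Let [Z] be the hypercentre. If the group is not nilpotent, some element of
    [S] is outside [Z]. An element outside [Z] has a commutator outside [Z] with
    some [x_c]; always choosing the largest such [c] gives an infinite sequence
    of elements outside [Z] and an infinite word [w] in the letters
    [0, ..., r-1]. Because larger letters act trivially, the Jacobi identity
    shows that on this sequence a window of [w] that is a Lyndon word [u] acts
    like a single element [[u]] of [S], its iterated commutator. The class
    conditions say that acting with [[u]] twice in a row, or with [[u]], [[v]],
    [[u]] in turn, is trivial. Hence [w] has no window [u u] or [u v u] with
    [u] and [v] Lyndon ([strong_system_sub_normal]).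

    But such windows, called sandwiches here, occur in every infinite word over
    a finite alphabet ([sandwich_unavoidable]). Otherwise there is a
    sandwich-free word [y] that is minimal among its shifts and in which every
    prefix recurs. Cut [y] into pieces, each consisting of a maximal match with
    the beginning of [y] and of the letter that breaks this match. A piece with a
    nonempty match is a Lyndon word [p q], with [p] a prefix of [y] and [p], [q]
    Lyndon, so to avoid [p q p] the next match must be shorter. After a piece
    that is a single letter [f], the next match is too short to contain the part
    of [y] up to and including some fixed piece [f]. So the matches are bounded
    ([reach_bound]), contradicting the recurrence of long prefixes. *)

(** * Words and Lyndon windows *)

(** Words are functions on the natural numbers; a finite word of length [n] is
    such a function of which only the first [n] values matter, so that windows
    of an infinite word need no new type. *)
Definition shift (k : nat) (w : nat -> nat) : nat -> nat := fun s => w (k + s).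

Definition agree (f g : nat -> nat) (n : nat) := forall s, s < n -> f s = g s.

Definition lexlt (f g : nat -> nat) := exists2 t, agree f g t & f t < g t.

(** A finite word is Lyndon when it is lexicographically smaller than each of its
    proper suffixes. A proper suffix that were a prefix would be smaller than
    the word, so the comparison is always decided by a differing letter inside
    the window. *)
Definition lyndon (f : nat -> nat) (n : nat) :=
  0 < n /\ forall k, 0 < k < n ->
    exists t, [/\ k + t < n, agree f (shift k f) t & f t < f (k + t)].

(** The middle [v] of a sandwich [u v u] may be empty, so that squares [u u] of
    Lyndon words count as well. *)
Definition has_sandwich (w : nat -> nat) :=
  exists i m l, [/\ lyndon (shift i w) m, l = 0 \/ lyndon (shift (i + m) w) l
                  & agree (shift i w) (shift (i + m + l) w) m].

Lemma lyndon_agree f g n : agree f g n -> lyndon f n -> lyndon g n.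
Proof.
move=> fg [n0 H]; split=> // k kn; have [t [ktn eqt ltt]] := H k kn.
exists t; split=> //; last by rewrite -!fg //; lia.
by move=> s st; rewrite /shift -!fg; [exact: eqt|lia|lia].
Qed.

Lemma first_difference f g n :
  f n <> g n -> exists t, [/\ t <= n, agree f g t & f t <> g t].
Proof.
elim/ltn_ind: n => n IHn fgn.
have [[m mn fgm]|nfg] := pselect (exists2 m, m < n & f m <> g m).
  by have [t [tm ? ?]] := IHn m mn fgm; exists t; split=> //; lia.
by exists n; split=> // s sn; apply: contra_notP nfg => fgs; exists s.
Qed.

Lemma lexlt_trans f g h : lexlt f g -> lexlt g h -> lexlt f h.
Proof.
move=> [t fg ltt] [u gh ltu]; case: (ltngtP t u) => tu.
- by exists t; [move=> s st; rewrite fg // gh //; lia|rewrite -gh].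
- by exists u; [move=> s st; rewrite fg ?gh //; lia|rewrite fg].
- by subst u; exists t; [move=> s st; rewrite fg // gh|lia].
Qed.

Lemma lexlt_minimal (F : nat -> nat -> nat) n : 0 < n ->
  exists2 k, 0 < k <= n & forall j, 0 < j <= n -> ~ lexlt (F j) (F k).
Proof.
elim: n => // -[_ _|n IHn _].
  exists 1 => // j ?; have -> : j = 1 by lia.
  by move=> [t _]; rewrite ltnn.
have [k kn kmin] := IHn isT.
have [lt|nlt] := pselect (lexlt (F n.+2) (F k)).
  exists n.+2; first lia.
  move=> j jn; have [->|jn2] := eqVneq j n.+2; first by move=> [t _]; rewrite ltnn.
  by move=> /lexlt_trans /(_ lt); apply: kmin; lia.
exists k; first lia.
by move=> j jn; have [->//|jn2] := eqVneq j n.+2; apply: kmin; lia.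
Qed.

(** The standard factorization. The cut is made in front of the smallest proper
    suffix, which is therefore Lyndon; were the remaining prefix [p] not Lyndon,
    it would have a suffix that is also its prefix, and cancelling that prefix
    would produce a still smaller proper suffix of the whole word. *)
Lemma lyndon_split f n : 1 < n -> lyndon f n ->
  exists k, [/\ 0 < k < n, lyndon f k & lyndon (shift k f) (n - k)].
Proof.
move=> n1 [n0 Hf].
(* Ending the word with a letter below all others makes a proper prefix smaller
   than the word, and makes all suffixes comparable as infinite words. *)
pose g s := if s < n then (f s).+1 else 0.
have gf s : s < n -> g s = (f s).+1 by rewrite /g => ->.
have [k kn kmin] := @lexlt_minimal (fun j => shift j g) n.-1 ltac:(lia).
exists k; split; first lia.
- split=> [|j jk]; first lia.
  have [t [jtn eqt ltt]] := Hf j ltac:(lia).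
  have [jtk|kjt] := ltnP (j + t) k; first by exists t.
  (* The suffix of [p] at [j] is a prefix of [p]; removing it from both sides
     compares the suffixes at [k - j] and at [k]. *)
  case: (kmin (k - j)); first lia.
  exists (t - (k - j)); last first.
    rewrite /shift !gf; [|lia|lia].
    have -> : k - j + (t - (k - j)) = t by lia.
    by have -> : k + (t - (k - j)) = j + t by lia.
  move=> s st; rewrite /shift !gf; [|lia|lia].
  by rewrite eqt /shift; [congr (f _).+1; lia|lia].
- split=> [|j jk]; first lia.
  have ne : shift k g (n - (k + j)) <> shift (k + j) g (n - (k + j)).
    by rewrite /shift gf ?/g; [|lia]; have -> : k + j + (n - (k + j)) < n = false by lia.
  have [t [tn eqt net]] := first_difference ne.
  have lt : shift k g t < shift (k + j) g t.
    rewrite ltn_neqAle; apply/andP; split; first by apply/eqP.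
    rewrite leqNgt; apply/negP => gt; apply: (kmin (k + j)); first lia.
    by exists t => // s /eqt.
  have kjt : k + j + t < n.
    rewrite ltnNge; apply/negP => h; move: lt.
    by rewrite /shift [g (k + j + t)]/g ifN // -leqNgt.
  exists t; split; first lia.
    move=> s st; have := eqt s st.
    by rewrite /shift !gf; [rewrite addnA => -[]|lia|lia].
  by move: lt; rewrite /shift !gf ?addnA //; lia.
Qed.

(** * Recurrent words that are minimal among their shifts *)

Definition shift_minimal (y : nat -> nat) :=
  forall j k, agree y (shift j y) k -> y k <= y (j + k).

Section RecurrentWord.
Variables (y : nat -> nat) (r : nat).
Hypothesis y_letters : forall i, y i < r.
Hypothesis y_min : shift_minimal y.
Hypothesis y_free : ~ has_sandwich y.

(** [m] is the length of the longest match at position [i] with the start of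
    [y], where the prefix of length [i] is Lyndon. Cutting just after the first
    letter that breaks the match decomposes [y] into pieces. *)
Definition piece i m := [/\ lyndon y i, agree y (shift i y) m & y m < y (i + m)].

(** A match of length [i] would repeat the Lyndon prefix of length [i], which is
    a sandwich with empty middle; the breaking letter is the larger one since
    [y] is minimal. *)
Lemma piece_exists i : lyndon y i -> exists2 m, m < i & piece i m.
Proof.
move=> Li; have i0 : 0 < i by case: Li.
have [nag|ag] := pselect (exists2 s, s < i & y s <> y (i + s)).
  have [s si ne] := nag.
  have [t [ts ag net]] := @first_difference y (shift i y) s ne.
  exists t; first lia.
  split=> //; have := y_min ag; move: net; rewrite /shift; lia.
case: y_free; exists 0, i, 0; split; [exact: Li|by left|].
by move=> s si; apply: contra_notP ag => ne; exists s => //; move: ne; rewrite /shift addn0.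
Qed.

(** A suffix that is also a prefix would start after [i], since the prefix of
    length [i] has none; the match would then copy it to the beginning of [y],
    where it ends with a letter larger than the one allowed by minimality. *)
Lemma piece_next i m : piece i m -> lyndon y (i + m).+1.
Proof.
move=> [[i0 Li] ag lt]; split=> // j jn.
have [ji|ij] := ltnP j i.
  by have [t [? ? ?]] := Li j ltac:(lia); exists t; split=> //; lia.
have agj : agree (shift (j - i) y) (shift j y) (i + m - j).
  move=> s sm; have := ag (j - i + s) ltac:(lia).
  by rewrite /shift => ->; congr y; lia.
have neq : ~ agree y (shift j y) (i + m - j).+1.
  move=> ag'; have := y_min (j := j - i) (k := i + m - j).
  have -> : j - i + (i + m - j) = m by lia.
  have := ag' (i + m - j) ltac:(lia); rewrite /shift.
  have -> : j + (i + m - j) = i + m by lia.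
  suff: agree y (shift (j - i) y) (i + m - j) by move=> /[swap] -> /[swap] /[apply]; lia.
  by move=> s sm; rewrite agj // ag' //; lia.
have [s sm ne] : exists2 s, s < (i + m - j).+1 & y s <> y (j + s).
  by apply: contra_notP neq => H s sm; apply: contra_notP H => ne; exists s.
have [t [ts agt net]] := @first_difference y (shift j y) s ne.
by exists t; split=> //; [lia|have := y_min agt; move: net; rewrite /shift; lia].
Qed.

(** A piece is the prefix of [y] of length [m] followed by a letter larger than
    the next letter of [y]; raising the last letter of a word that is minimal
    among its suffixes makes these strictly larger. *)
Lemma piece_lyndon i m : piece i m -> lyndon (shift i y) m.+1.
Proof.
move=> [_ ag lt]; split=> // j jm.
have agj : forall s, s < m - j -> y (i + (j + s)) = y (j + s).
  by move=> s sm; rewrite (ag (j + s)) //; lia.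
have [ag'|nag] := pselect (agree y (shift j y) (m - j)).
  exists (m - j); split; first lia.
    move=> s sm; rewrite /shift agj // -/(shift j y s) -ag' //.
    by rewrite (ag s) //; lia.
  rewrite /shift; have -> : j + (m - j) = m by lia.
  have := y_min ag'; have -> : j + (m - j) = m by lia.
  by rewrite (ag (m - j)) /shift; [lia|lia].
have [s sm ne] : exists2 s, s < m - j & y s <> y (j + s).
  by apply: contra_notP nag => H s sm; apply: contra_notP H => ne; exists s.
have [t [ts agt net]] := @first_difference y (shift j y) s ne.
exists t; split; first lia.
  move=> u ut; rewrite /shift agj; last lia.
  by rewrite -/(shift j y u) -agt // (ag u) //; lia.
rewrite /shift agj; last lia.
have := y_min agt; move: net; rewrite /shift.
by rewrite (ag t) /shift; lia.
Qed.

Inductive reach : nat -> nat -> Prop :=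
| reach1 : piece 1 0 -> reach 1 0
| reachS i m m' : reach i m -> piece (i + m).+1 m' -> reach (i + m).+1 m'.

Lemma reach_piece i m : reach i m -> piece i m.
Proof. by case. Qed.

Lemma lyndon1 f : lyndon f 1.
Proof. by split=> // k; lia. Qed.

Lemma reach_cover j : 0 < j -> exists i m, reach i m /\ i <= j <= i + m.
Proof.
elim: j => // -[_ _|j IHj _].
  have [m m1 pm] := piece_exists (lyndon1 y).
  have m0 : m = 0 by lia.
  by subst m; exists 1, 0; split; [exact: reach1|lia].
have [i [m [rim ij]]] := IHj isT.
have [jm|mj] := leqP j.+2 (i + m); first by exists i, m; split=> //; lia.
have [m' _ pm'] := piece_exists (piece_next (reach_piece rim)).
by exists (i + m).+1, m'; split; [exact: reachS|lia].
Qed.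

(** The heart of the argument: matches cannot be long. Let a piece with match [m]
    be followed by a piece with match [m'].
    If [m] is positive, the first piece is a Lyndon word of length at least 2, so
    it is [p q] with [p] and [q] Lyndon, where [p] is a prefix of [y]; a next
    match of length at least [m] would start with [p] and give [p q p]. Hence
    [m'] is smaller than [m].
    If [m] is 0, the piece is a single letter [f]. Let [i0] be the position of
    a fixed piece consisting of [f] alone; the prefix [v] of length [i0] is
    Lyndon, so a next match longer than [i0] would give [f v f]. As there are
    finitely many letters, this bounds [m'] uniformly. *)
Lemma reach_bound : exists M, forall i m, reach i m -> m < M.
Proof.
have [M HM] : exists M, forall f, f < r -> (exists2 i, reach i 0 & y i = f) ->
    exists i, [/\ reach i 0, y i = f & i < M].
  elim: (r) => [|q [M HM]]; first by exists 0.
  have [[i ri yi]|no] := pselect (exists2 i, reach i 0 & y i = q).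
    exists (maxn M i.+1) => f fq ex; have [->|fnq] := eqVneq f q.
      by exists i; split=> //; lia.
    by have [j [? ? ?]] := HM f ltac:(lia) ex; exists j; split=> //; lia.
  exists M => f fq ex; apply: HM => //.
  by have [e|?] := eqVneq f q; [case: no; rewrite -e|lia].
exists M.+1 => i m; elim=> // {}i {}m m' rim mM pm'.
(* The induction hypothesis bounds [m], so it suffices to rule out both cases
   above for a match [m'] exceeding the bound. *)
have pim := reach_piece rim; have [_ ag' _] := pm'.
rewrite ltnNge; apply/negP => Mm'; apply: y_free.
case: m => [|m] in rim mM pim pm' ag' *.
  have [i0 [ri0 yi0 i0M]] := HM (y i) (y_letters i) ltac:(by exists i).
  have [Li0 _ _] := reach_piece ri0.
  exists i, 1, i0; split; first exact: lyndon1.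
    right; apply: lyndon_agree Li0 => s si0.
    by rewrite ag' /shift; [congr y; lia|lia].
  move=> s s1; have -> : s = 0 by lia.
  rewrite /shift addn0 -yi0 ag' /shift; [congr y; lia|lia].
have [k [km Lk Lk']] := lyndon_split (isT : 1 < m.+2) (piece_lyndon pim).
exists i, k, (m.+2 - k); split=> //.
  by right; apply: lyndon_agree Lk' => s _; rewrite /shift; congr y; lia.
have [_ ag _] := pim; move=> s sk.
rewrite -ag; last lia; rewrite ag' /shift; [congr y; lia|lia].
Qed.

(** The first recurrence of a prefix longer than all matches cannot start a piece.
    If it starts inside one, the match of that piece moves it to an earlier
    recurrence, unless the letter breaking the match falls inside it; in the
    latter case the moved window is smaller than the start of [y]. *)
Lemma not_recurrent : ~ (forall n, exists2 j, 0 < j & agree y (shift j y) n).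
Proof.
move=> rec; have [M HM] := reach_bound.
have [j j0 agj] := rec M.
elim/ltn_ind: j j0 agj => j IHj j0 agj.
have [i [m [rim ij]]] := reach_cover j0.
have mM := HM _ _ rim; have [_ ag lt] := reach_piece rim.
have [eij|nij] := eqVneq i j.
  by subst j; have := agj m mM; rewrite /shift; lia.
have agij : forall s, s < i + m - j -> y (j - i + s) = y (j + s).
  by move=> s sm; rewrite (ag (j - i + s)) /shift; [congr y; lia|lia].
have [Mm|mM'] := leqP M (i + m - j).
  by apply: (IHj (j - i)); [lia|lia|move=> s sM; rewrite /shift agij ?agj //; lia].
have := @y_min (j - i) (i + m - j).
have -> : j - i + (i + m - j) = m by lia.
rewrite (agj (i + m - j)) // /shift; have -> : j + (i + m - j) = i + m by lia.
suff ag2 : agree y (shift (j - i) y) (i + m - j) by move/(_ ag2); lia.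
by move=> s sm; rewrite /shift agij // agj //; lia.
Qed.
End RecurrentWord.

(** * Every infinite word over a finite alphabet contains a sandwich *)
Lemma agreeP f g n : reflect (agree f g n) (mkseq f n == mkseq g n).
Proof.
apply: (iffP eqP) => [e s sn|fg].
  by rewrite -(nth_mkseq 0 f sn) e nth_mkseq.
by apply/eq_in_map => s; rewrite mem_iota add0n => /= /fg.
Qed.

(** Builds an infinite word letter by letter inside a tree of finite words, each
    time taking a cheapest letter that stays in the tree. It serves both for
    smallest and for largest words. *)
Lemma greedy_word (cost : nat -> nat) (Q : seq nat -> Prop) :
  Q [::] -> (forall s, Q s -> exists c, Q (rcons s c)) ->
  exists y, forall n, Q (mkseq y n) /\
    forall c, Q (rcons (mkseq y n) c) -> cost (y n) <= cost c.
Proof.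
move=> Q0 QS.
have step s : exists c, Q s ->
    Q (rcons s c) /\ forall d, Q (rcons s d) -> cost c <= cost d.
  have [Qs|nQ] := pselect (Q s); last by exists 0.
  have ex : exists k, `[< exists2 c, Q (rcons s c) & cost c = k >].
    by have [c Qc] := QS s Qs; exists (cost c); apply/asboolP; exists c.
  case: (ex_minnP ex) => k /asboolP [c Qc ck] kmin.
  exists c => _; split=> // d Qd; rewrite ck; apply: kmin; apply/asboolP.
  by exists d.
have [next nextP] := choice step.
pose pre := fix pre n := if n is m.+1 then rcons (pre m) (next (pre m)) else [::].
pose y n := next (pre n).
have preE n : pre n = mkseq y n by elim: n => //= n IHn; rewrite mkseqS -IHn.
have Qpre n : Q (pre n) by elim: n => //= n /nextP[].
by exists y => n; rewrite -preE; split=> //; case: (nextP _ (Qpre n)).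
Qed.

(** The lexicographically smallest word all of whose prefixes occur infinitely
    often in [w]. Its windows occur infinitely often as well, which makes it
    minimal among its shifts. *)
Lemma minimal_word r w : (forall i, w i < r) ->
  exists2 y, shift_minimal y &
    forall n N, exists2 j, N <= j & agree y (shift j w) n.
Proof.
move=> wr.
pose Q s := forall N, exists2 j, N <= j & s = mkseq (shift j w) (size s).
have Q0 : Q [::] by move=> N; exists N.
have QS s : Q s -> exists c, Q (rcons s c).
  move=> Qs; apply: contrapT => noc.
  have [N HN] : exists N, forall c, c < r -> forall j, N <= j ->
      rcons s c <> mkseq (shift j w) (size s).+1.
    elim: (r) => [|q [N HN]]; first by exists 0.
    have [N' HN'] : exists N', forall j, N' <= j ->
        rcons s q <> mkseq (shift j w) (size s).+1.
      apply: contra_notP noc => H; exists q => K.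
      apply: contra_notP H => H; exists K => j Kj e.
      by apply: H; exists j => //; rewrite size_rcons.
    exists (maxn N N') => c cq j Nj; have [->|cnq] := eqVneq c q.
      by apply: HN'; lia.
    by apply: HN; lia.
  have [j Nj sj] := Qs N; apply: (HN (w (j + size s)) (wr _) j Nj).
  by rewrite mkseqS -sj.
have [y yP] := greedy_word id Q0 QS.
have yio n N : exists2 j, N <= j & agree y (shift j w) n.
  have [Qn _] := yP n; have [j Nj] := Qn N.
  by rewrite size_mkseq => /eqP/agreeP; exists j.
exists y => // j k yj; have [_ /(_ (y (j + k)))] := yP k; apply=> N.
have [i Ni yi] := yio (j + k).+1 N; exists (i + j); first lia.
rewrite size_rcons size_mkseq mkseqS; congr rcons.
  apply/eqP/agreeP => s sk; rewrite yj // /shift yi /shift ?addnA //; lia.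
by rewrite yi /shift ?addnA.
Qed.

Lemma sandwich_free_sub y w :
  (forall i n, exists j, agree (shift i y) (shift j w) n) ->
  ~ has_sandwich w -> ~ has_sandwich y.
Proof.
move=> sub free [i [m [l [Lm Ll e]]]]; apply: free.
have [j yj] := sub i (m + l + m); exists j, m, l; split.
- by apply: lyndon_agree Lm => s sm; rewrite yj //; lia.
- case: Ll => [|Ll]; [by left|right]; apply: lyndon_agree Ll => s sl.
  by have := yj (m + s) ltac:(lia); rewrite /shift !addnA.
move=> s sm; rewrite -yj; last lia.
rewrite e // /shift; have := yj (m + l + s) ltac:(lia).
by rewrite /shift !addnA.
Qed.

(** Among the sandwich-free words that are minimal among their shifts, take the
    lexicographically largest one, [y]; it exists because these conditions only
    involve finite windows. If some prefix of [y] did not recur, then the minimal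
    word extracted from [y] would avoid that prefix and hence be larger than
    [y]. So [y] is recurrent, which is impossible. *)
Theorem sandwich_unavoidable r w : (forall i, w i < r) -> has_sandwich w.
Proof.
move=> wr; apply: contrapT => wfree.
pose M y := [/\ forall i, y i < r, ~ has_sandwich y & shift_minimal y].
have minM x : (forall i, x i < r) -> ~ has_sandwich x ->
    exists2 y, M y & forall n N, exists2 j, N <= j & agree y (shift j x) n.
  move=> xr xfree; have [y ymin yx] := minimal_word xr.
  exists y => //; split=> //.
    by move=> i; have [j _ ->] := yx i.+1 0; [exact: xr|].
  apply: sandwich_free_sub xfree => i n; have [j _ yj] := yx (i + n) 0.
  exists (j + i) => s sn; rewrite /shift yj /shift ?addnA //; lia.
pose Q s := exists2 y, M y & s = mkseq y (size s).
have Q0 : Q [::] by have [y My _] := minM w wr wfree; exists y.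
have QS s : Q s -> exists c, Q (rcons s c).
  move=> [y My sy]; exists (y (size s)); exists y => //.
  by rewrite size_rcons mkseqS -sy.
have [y yP] := greedy_word (fun c => r - c) Q0 QS.
have Qy n : exists2 z, M z & agree y z n.
  have [[z Mz +] _] := yP n.
  by rewrite size_mkseq => /eqP/agreeP; exists z.
have yr i : y i < r by have [z [zr _ _] yz] := Qy i.+1; rewrite yz.
have yfree : ~ has_sandwich y.
  move=> [i [m [l [Lm Ll e]]]]; have [z [_ zfree _] yz] := Qy (i + m + l + m).
  apply: zfree; exists i, m, l; split.
  - by apply: lyndon_agree Lm => s sm; rewrite /shift yz //; lia.
  - case: Ll => [|Ll]; [by left|right].
    by apply: lyndon_agree Ll => s sl; rewrite /shift yz //; lia.
  by move=> s sm; have := e s sm; rewrite /shift !yz //; lia.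
have ymin : shift_minimal y.
  move=> j k yj; have [z [_ _ zmin] yz] := Qy (j + k).+1.
  rewrite !yz; [|lia|lia]; apply: zmin => s sk.
  by have := yj s sk; rewrite /shift !yz //; lia.
apply: (@not_recurrent y r yr ymin yfree) => n.
have [z [zr zfree zmin] zy] := minM y yr yfree.
have ezy : agree z y n.
  elim: n => // n IHn s; rewrite ltnS leq_eqVlt => /predU1P[->|/IHn//].
  apply/eqP; rewrite eqn_leq; apply/andP; split.
    have : Q (rcons (mkseq y n) (z n)).
      exists z => //; rewrite size_rcons size_mkseq mkseqS; congr rcons.
      by apply/esym/eqP/agreeP.
    by move=> /(proj2 (yP n)); have := zr n; have := yr n; lia.
  have [j _ zj] := zy n.+1 0; rewrite zj // /shift.
  by apply: ymin => u un; rewrite -IHn // zj //; lia.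
have [j j1 zj] := zy n 1; exists j => // s sn.
by rewrite -ezy // zj.
Qed.

Local Open Scope group_scope.
Local Open Scope classical_set_scope.

(** * Strong systems and their closure under commutators *)
Section CommuteFacts.
Variable G : groupType.
Implicit Types x y z : G.

Lemma commuteJ x y z : commute x y -> commute x z -> commute x (y ^ z).
Proof. by move=> xy xz; do 2?apply: commuteM => //; apply: commuteV. Qed.

Lemma commuteR x y z : commute x y -> commute x z -> commute x [~ y, z].
Proof. by move=> xy xz; apply: commuteM; [exact: commuteV|exact: commuteJ]. Qed.

Lemma commute_conj x y z : commute (x ^ z) (y ^ z) <-> commute x y.
Proof.
by split=> [|xy]; rewrite /commute -!conjMg ?xy // => /conjg_inj.
Qed.

Lemma commute_conjgE x y : commute x y -> x ^ y = x.
Proof. by move/commgP/conjg_fixP. Qed.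

Lemma commuteRC x y z : commute x [~ y, z] -> commute x [~ z, y].
Proof. by rewrite -[[~ z, y]]invgR; apply: commuteV. Qed.

Lemma conjg_mulR x y : x ^ y = x * [~ x, y].
Proof. by rewrite mulVKg. Qed.

Lemma commgMJ x y z : [~ x * y, z] = [~ x, z] ^ y * [~ y, z].
Proof. by rewrite /commg /conjg !invgM !mulgA !mulgK. Qed.

Lemma commgJM x y z : [~ x, y * z] = [~ x, z] * [~ x, y] ^ z.
Proof. by rewrite /commg /conjg !invgM !mulgA !mulgK. Qed.

Lemma commVg x y : [~ x^-1, y] = ([~ x, y] ^ x^-1)^-1.
Proof. by rewrite /commg /conjg !invgM !invgK !mulgA mulgK. Qed.

Lemma commgV x y : [~ x, y^-1] = ([~ x, y] ^ y^-1)^-1.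
Proof. by rewrite /commg /conjg !invgM !invgK !mulgA mulgV mul1g. Qed.

(** Writing [[~ x, y]] as [x^-1 * x ^ y] turns a triple commutator into a product
    of two commutators with the same right entry [z]. *)
Lemma commg_split x y z : commute [~ x, y] [~ x, z] ->
  [~ [~ x, y], z] = [~ x, z]^-1 * [~ x ^ y, z].
Proof.
move=> c; apply: (mulgI [~ x, y]); rewrite -conjg_mulR.
rewrite mulgA [_ * _^-1](commuteV c) -mulgA.
by rewrite /commg /conjg !invgM !invgK !mulgA !(mulgK, mulgVK).
Qed.

End CommuteFacts.

Section Strong.
Variable G : groupType.
Implicit Types (S : set G) (a b c d u v x y z h p q : G).

(** For a set closed under conjugation and inversion, the two commutation rules
    express the class conditions of a strong sandwich set: the first one for
    pairs, the second one, given the first, for triples. In the language of Lie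
    algebras they say that [ad a ^ 2] and [ad a ad y ad a] vanish. *)
Record strong_system S : Prop := StrongSystem {
  strongJ : forall a g, S a -> S (a ^ g);
  strongV : forall a, S a -> S a^-1;
  strong_pair : forall a x, S a -> S x -> commute a [~ x, a];
  strong_triple : forall a x y, S a -> S x -> S y -> commute [~ x, a] [~ y, a] }.

Section Facts.
Variable S : set G.
Hypothesis sS : strong_system S.

Lemma strong_pairR a x : S a -> S x -> commute a [~ a, x].
Proof. by move=> Sa Sx; apply: commuteRC; apply: (strong_pair sS). Qed.

Lemma strong_tripleR a x y : S a -> S x -> S y -> commute [~ a, x] [~ a, y].
Proof.
move=> Sa Sx Sy; apply: commuteRC; apply/commute_sym; apply: commuteRC.
exact: (strong_triple sS).
Qed.

Lemma bracket3_split a b c : S a -> S b -> S c ->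
  [~ [~ a, b], c] = [~ a, c]^-1 * [~ a ^ b, c].
Proof. by move=> Sa Sb Sc; apply: commg_split; apply: strong_tripleR. Qed.

(** All commutators [[~ v, c]] with [v] in [S] commute with each other, and
    [[~ [~ a, b], c]] is a product of two of them and their inverses; so it
    inherits whatever commutes with all of them. *)
Lemma bracket3_centr a b c g : S a -> S b -> S c ->
  (forall v, S v -> commute g [~ v, c]) -> commute g [~ [~ a, b], c].
Proof.
move=> Sa Sb Sc gc; rewrite bracket3_split //.
by apply: commuteM; [apply: commuteV|]; apply: gc => //; apply: (strongJ sS).
Qed.

Lemma bracket3_comm3 a b c : S a -> S b -> S c -> commute c [~ [~ a, b], c].
Proof. by move=> Sa Sb Sc; apply: bracket3_centr => // v Sv; apply: (strong_pair sS). Qed.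

Lemma bracket3_comm1 a b c : S a -> S b -> S c -> commute a [~ [~ a, b], c].
Proof.
move=> Sa Sb Sc; have au := strong_pairR Sa Sb.
apply: commuteM; first exact: commuteV.
apply/(commute_conj _ _ c^-1); rewrite conjgK conjg_mulR.
apply/commute_sym/commuteM; first exact: commute_sym.
by apply: strong_tripleR => //; apply: (strongV sS).
Qed.

Lemma bracket3_comm2 a b c : S a -> S b -> S c -> commute b [~ [~ a, b], c].
Proof.
move=> Sa Sb Sc; have bu := strong_pair sS Sb Sa.
apply: commuteM; first exact: commuteV.
apply/(commute_conj _ _ c^-1); rewrite conjgK conjg_mulR.
apply/commute_sym/commuteM; first exact: commute_sym.
by apply: commuteRC; apply: (strong_triple sS) => //; apply: (strongV sS).
Qed.

(** In a group of class 3 triple commutators are additive; expanding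
    [[~ a ^ y, b ^ y]] gives the Leibniz rule. Each conjugation that appears is
    trivial by one of the commutation rules. *)
Lemma bracket3_leibniz a b y : S a -> S b -> S y ->
  [~ [~ a, b], y] = [~ a, [~ b, y]] * [~ [~ a, y], b].
Proof.
move=> Sa Sb Sy.
set u := [~ a, b]; set al := [~ a, y]; set be := [~ b, y].
have u_al : commute u al by apply: strong_tripleR.
have u_be : commute u be by apply/commute_sym/commuteRC/strong_tripleR.
have al_be : commute al be by apply: (strong_triple sS).
have q_be : commute [~ al, b] be.
  by apply/commuteR; apply/commute_sym; [apply: bracket3_comm3|apply: bracket3_comm2].
have p_a : commute [~ a, be] a by apply/commute_sym/commuteRC/bracket3_comm3.
have p_y : commute [~ a, be] y by apply/commute_sym/commuteRC/bracket3_comm2.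
have p_b : commute [~ a, be] b by apply/commute_sym/commuteRC/bracket3_comm1.
have p_al : commute [~ a, be] al by apply: commuteR.
have p_u : commute [~ a, be] u by apply: commuteR.
have -> : [~ u, y] = u^-1 * [~ a * al, b * be].
  by rewrite {1}/commg conjRg -!conjg_mulR.
rewrite commgJM [[~ a * al, b]]commgMJ [[~ a * al, be]]commgMJ.
have -> : [~ al, be] = 1 by apply/eqP/commgP.
rewrite mulg1 (commute_conjgE p_al) -/u (commute_conjgE u_al) conjMg.
rewrite (commute_conjgE u_be) (commute_conjgE q_be).
have swap P Q v : commute P v -> v^-1 * (P * (v * Q)) = P * Q.
  by move=> Pv; rewrite (mulgA P) Pv -mulgA mulKg.
exact: swap.
Qed.

(** This is the triple rule for the commutator [u = [~ a, b]]. By the Leibniz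
    rule [[~ u, y]] is a product of a factor that is a product of commutators
    [[~ v, a]^+-1] and of one that is a product of commutators [[~ v, b]^+-1].
    Factors of the same kind commute; factors of different kinds commute since
    the first commutes with [[~ a, z]] and with [b]. *)
Lemma bracket3_commute a b y z : S a -> S b -> S y -> S z ->
  commute [~ [~ a, b], y] [~ [~ a, b], z].
Proof.
move=> Sa Sb Sy Sz; rewrite (bracket3_leibniz Sa Sb Sy) (bracket3_leibniz Sa Sb Sz).
have PP : commute [~ a, [~ b, y]] [~ a, [~ b, z]].
  apply: commuteRC; apply: bracket3_centr => // v Sv; apply/commute_sym/commuteRC.
  by apply: bracket3_centr => // w Sw; apply: (strong_triple sS).
have QQ : commute [~ [~ a, y], b] [~ [~ a, z], b].
  apply: bracket3_centr => // v Sv; apply/commute_sym.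
  by apply: bracket3_centr => // w Sw; apply: (strong_triple sS).
have PQ x w : S x -> S w -> commute [~ a, [~ b, x]] [~ [~ a, w], b].
  move=> Sx Sw; apply: commuteR; apply/commute_sym/commuteRC.
    by apply: bracket3_centr => // v Sv; apply/commute_sym/commuteRC/(strong_triple sS).
  exact: bracket3_comm1.
apply: commuteM; apply/commute_sym; apply: commuteM; apply/commute_sym.
- exact: PP.
- by apply/commute_sym; apply: PQ.
- exact: PQ.
- exact: QQ.
Qed.

End Facts.

Definition add_brackets S : set G :=
  [set x | S x \/ exists a b, [/\ S a, S b & x = [~ a, b]]].

(** A commutator with entry [[~ c, d]] on the left and [a] or [[~ a, b]] on the
    right splits into commutators of elements of [S] with the same right entry.
    Hence whatever commutes with the latter commutes with the former, and every
    rule reduces to one whose other entries are in [S]. *)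
Lemma strong_add_brackets S : strong_system S -> strong_system (add_brackets S).
Proof.
move=> sS.
have S_centr a x g : S a -> add_brackets S x ->
    (forall v, S v -> commute g [~ v, a]) -> commute g [~ x, a].
  move=> Sa [Sx|[b [c [Sb Sc ->]]]] gU; first exact: gU.
  exact: (bracket3_centr sS).
have S_triple a x y : S a -> add_brackets S x -> add_brackets S y ->
    commute [~ x, a] [~ y, a].
  move=> Sa Sx Sy; apply: (S_centr) => // v Sv; apply/commute_sym.
  by apply: (S_centr) => // w Sw; apply: (strong_triple sS).
have bracket_centr a b x g : S a -> S b -> add_brackets S x ->
    (forall v, S v -> commute g [~ v, [~ a, b]]) -> commute g [~ x, [~ a, b]].
  move=> Sa Sb [Sx|[c [d [Sc Sd ->]]]] gU; first exact: gU.
  rewrite commg_split; last first.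
    apply/commuteRC/commute_sym/commuteRC.
    by apply: (S_triple) => //; [right; exists a, b|left].
  by apply: commuteM; [apply: commuteV|]; apply: gU => //; apply: (strongJ sS).
split.
- move=> a g [Sa|[b [c [Sb Sc ->]]]]; first by left; apply: (strongJ sS).
  by right; exists (b ^ g), (c ^ g); rewrite conjRg; split=> //; apply: (strongJ sS).
- move=> a [Sa|[b [c [Sb Sc ->]]]]; first by left; apply: (strongV sS).
  by right; exists c, b; rewrite invgR.
- move=> a x [Sa|[b [c [Sb Sc ->]]]] Sx.
    by apply: (S_centr) => // v Sv; apply: (strong_pair sS).
  apply: (bracket_centr) => // v Sv; apply/commuteRC/commute_sym.
  apply: commuteR; apply/commute_sym.
    exact: (bracket3_comm1 sS).
  exact: (bracket3_comm2 sS).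
- move=> a x y [Sa|[b [c [Sb Sc ->]]]] Sx Sy; first exact: S_triple.
  apply: (bracket_centr) => // v Sv; apply/commute_sym; apply: (bracket_centr) => // w Sw.
  apply/commuteRC/commute_sym/commuteRC.
  exact: (bracket3_commute sS).
Qed.

Definition brackets S : set G := [set x | exists n, iter n add_brackets S x].

Lemma iter_add_brackets_leq S m n x : m <= n ->
  iter m add_brackets S x -> iter n add_brackets S x.
Proof. by move=> /subnK <-; elim: (n - m)%N => // k IHk /IHk; left. Qed.

Lemma strong_brackets S : strong_system S -> strong_system (brackets S).
Proof.
move=> sS; have sn n : strong_system (iter n add_brackets S).
  by elim: n => //= n; apply: strong_add_brackets.
split.
- by move=> a g [n Sa]; exists n; apply: (strongJ (sn n)).
- by move=> a [n Sa]; exists n; apply: (strongV (sn n)).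
- move=> a x [m Sa] [n Sx]; apply: (strong_pair (sn (maxn m n))).
    by apply: iter_add_brackets_leq Sa; lia.
  by apply: iter_add_brackets_leq Sx; lia.
- move=> a x y [m Sa] [n Sx] [k Sy]; apply: (strong_triple (sn (maxn m (maxn n k)))).
  + by apply: iter_add_brackets_leq Sa; lia.
  + by apply: iter_add_brackets_leq Sx; lia.
  + by apply: iter_add_brackets_leq Sy; lia.
Qed.

Lemma bracketsR S a b : brackets S a -> brackets S b -> brackets S [~ a, b].
Proof.
move=> [m Sa] [n Sb]; exists (maxn m n).+1.
right; exists a, b; split=> //.
  by apply: iter_add_brackets_leq Sa; lia.
by apply: iter_add_brackets_leq Sb; lia.
Qed.

Lemma sub_brackets S : S `<=` brackets S.
Proof. by move=> x Sx; exists 0. Qed.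

End Strong.

(** * Commutators modulo a normal subgroup, and the hypercentre *)
Section NormalSubgroup.
Variable G : groupType.
Implicit Types x y z g h p q t : G.

Record normal_subgroup (Z : set G) : Prop := NormalSubgroup {
  normal1 : Z 1;
  normalM : forall x y, Z x -> Z y -> Z (x * y);
  normalV : forall x, Z x -> Z x^-1;
  normalJ : forall x g, Z x -> Z (x ^ g) }.

Section Facts.
Variable Z : set G.
Hypothesis nZ : normal_subgroup Z.

Lemma normalRl x y : Z x -> Z [~ x, y].
Proof. by move=> Zx; apply: (normalM nZ); [apply: (normalV nZ)|apply: (normalJ nZ)]. Qed.

(** Congruence modulo [Z]: working with it replaces the passage to a quotient
    group. *)
Definition cong x y := Z (x^-1 * y).

Lemma cong_refl x : cong x x.
Proof. by rewrite /cong mulVg; apply: (normal1 nZ). Qed.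

Lemma cong_sym x y : cong x y -> cong y x.
Proof. by move/(normalV nZ); rewrite invgM invgK. Qed.

Lemma cong_trans y x z : cong x y -> cong y z -> cong x z.
Proof. by move=> xy /(normalM nZ xy); rewrite -mulgA mulVKg. Qed.

Lemma congM x x' y y' : cong x x' -> cong y y' -> cong (x * y) (x' * y').
Proof.
move=> xx yy; rewrite /cong invgM -mulgA (mulgA _ x') (conjgC (_ * x')) mulgA.
by apply: (normalM nZ) => //; apply: (normalJ nZ).
Qed.

Lemma congV x x' : cong x x' -> cong x^-1 x'^-1.
Proof.
move=> xx; have := normalJ nZ x^-1 (cong_sym xx).
by rewrite /cong /conjg !invgK !mulgA mulgK.
Qed.

Lemma cong1 x : cong x 1 <-> Z x.
Proof.
by rewrite /cong mulg1; split=> /(normalV nZ); rewrite ?invgK.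
Qed.

Lemma congR x x' y : cong x x' -> cong [~ x, y] [~ x', y].
Proof.
move=> xx; apply: congM; first exact: congV.
by apply: congM; [exact: cong_refl|apply: congM => //; exact: cong_refl].
Qed.

Lemma cong_in x y : cong x y -> Z y -> Z x.
Proof. by move=> /cong_trans xy /cong1 /xy /cong1. Qed.

End Facts.

(** The Jacobi identity [h (p q - q p) = h p q], valid when [h q] vanishes. The
    three elements generate a group of class at most 3, where it holds exactly;
    here [h] and [q] commute only modulo [Z], and the error terms stay in [Z]. *)
Lemma strong_jacobi S Z h p q : strong_system S -> normal_subgroup Z ->
  S h -> S p -> S q -> Z [~ h, q] -> cong Z [~ h, [~ p, q]] [~ [~ h, p], q].
Proof.
move=> sS nZ Sh Sp Sq Zhq; set c := [~ h, p].
have c_p : commute c p by apply/commute_sym/(strong_pair sS).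
have c_pq : commute c (p ^ q).
  rewrite conjg_mulR; apply: commuteM => //.
  by apply: commuteRC; apply: (strong_triple sS).
have c_cq : commute c (c ^ q).
  rewrite conjg_mulR; apply: commuteM => //; apply/commute_sym.
  rewrite {2}/c; apply/commute_sym.
  by apply/commute_sym/commuteR; apply/commute_sym;
    [exact: (bracket3_comm1 sS)|exact: (bracket3_comm2 sS)].
have hpV : h ^ p^-1 = h * c^-1.
  apply: (@conjg_inj _ p); rewrite conjgKV conjMg conjVg.
  by rewrite (commute_conjgE c_p) conjg_mulR mulgK.
have hq : cong Z (h ^ q) h.
  rewrite conjg_mulR -[X in cong Z _ X]mulg1.
  by apply: (congM nZ); [exact: cong_refl|exact/(cong1 nZ)].
have conjC x y z : cong Z x y -> cong Z (x ^ z) (y ^ z).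
  move=> xy; rewrite /conjg; apply: (congM nZ); first exact: cong_refl.
  by apply: (congM nZ) => //; exact: cong_refl.
have hqV : cong Z (h ^ q^-1) h.
  by have := cong_sym nZ (conjC _ _ q^-1 hq); rewrite conjgK.
have hpq : cong Z (h ^ (p ^ q)) (h * c ^ q).
  have -> : h ^ (p ^ q) = ((h ^ q^-1) ^ p) ^ q by rewrite -!conjgM.
  apply: (cong_trans nZ (conjC _ _ q (conjC _ _ p hqV))).
  rewrite [h ^ p]conjg_mulR -/c conjMg.
  by apply: (congM nZ) => //; exact: cong_refl.
have -> : [~ h, [~ p, q]] = h^-1 * (h ^ (p ^ q) * c^-1).
  rewrite {1}/commg [[~ p, q]]/commg conjgM hpV conjMg conjVg.
  by rewrite (commute_conjgE c_pq).
have -> : [~ c, q] = h^-1 * (h * c ^ q * c^-1).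
  by rewrite -mulgA mulKg [RHS](commuteV (commute_sym c_cq)).
apply: (congM nZ); first exact: cong_refl.
by apply: (congM nZ) => //; exact: cong_refl.
Qed.

(** The upper central series. *)
Fixpoint hypercentral n g : Prop :=
  if n is m.+1 then forall y, hypercentral m [~ g, y] else g = 1.

Lemma hypercentral_normal n : normal_subgroup (hypercentral n).
Proof.
elim: n => [|n nZ] /=.
  split=> //= [x y -> ->|x ->|x g ->]; first by rewrite mulg1.
    by rewrite invg1.
  by rewrite conj1g.
have J x g : (forall y, hypercentral n [~ x, y]) ->
    forall y, hypercentral n [~ x ^ g, y].
  by move=> Zx y; rewrite -[y](conjgKV g) -conjRg; apply: (normalJ nZ).
split.
- by move=> y; rewrite comm1g; apply: (normal1 nZ).
- move=> x y Zx Zy t; rewrite commgMJ; apply: (normalM nZ) => //.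
  exact: (normalJ nZ).
- move=> x Zx y.
  by rewrite commVg; apply/(normalV nZ)/(normalJ nZ).
- by [].
Qed.

Lemma hypercentral_leq m n g : m <= n -> hypercentral m g -> hypercentral n g.
Proof.
move=> /subnK <-; elim: (n - m)%N => // k IHk /IHk {IHk}.
rewrite addSn; move: (k + m)%N => {k m}.
move=> k Zg y; exact: (normalRl (hypercentral_normal k)).
Qed.

Definition hypercenter : set G := [set g | exists n, hypercentral n g].

Lemma hypercenter_normal : normal_subgroup hypercenter.
Proof.
split.
- by exists 0.
- move=> x y [m Zx] [n Zy]; exists (maxn m n); apply: (normalM (hypercentral_normal _)).
    by apply: hypercentral_leq Zx; lia.
  by apply: hypercentral_leq Zy; lia.
- by move=> x [n Zx]; exists n; apply: (normalV (hypercentral_normal _)).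
- by move=> x g [n Zx]; exists n; apply: (normalJ (hypercentral_normal _)).
Qed.

Lemma generated_ind (A P : set G) : A `<=` P -> P 1 ->
  (forall x y, P x -> P y -> P (x / y)) -> generated A `<=` P.
Proof.
move=> AP P1 PB; apply: smallest_sub => //; split; first exact/mem_set.
by move=> x y /set_mem Px /set_mem Py; apply/mem_set/PB.
Qed.

Lemma common_level (P : nat -> nat -> Prop) r :
  (forall m n i, m <= n -> P m i -> P n i) ->
  (forall i, i < r -> exists n, P n i) -> exists n, forall i, i < r -> P n i.
Proof.
move=> mono; elim: r => [|r IHr] H; first by exists 0.
have [n Hn] := IHr (fun i ir => H i (ltnW ir)); have [m Hm] := H r (ltnSn r).
exists (maxn m n) => i; rewrite ltnS leq_eqVlt => /predU1P[->|ir].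
  by apply: mono Hm; lia.
by apply: mono (Hn i ir); lia.
Qed.

(** Modulo the hypercentre of a finitely generated group the centre is trivial:
    this is the hypothesis under which greedy words never stop. *)
Lemma hypercenter_gen (x : nat -> G) r h :
  generated [set x i | i in [set i | i < r]] = [set: G] ->
  (forall i, i < r -> hypercenter [~ h, x i]) -> hypercenter h.
Proof.
move=> gen Hx.
have [n Hn] := @common_level (fun n i => hypercentral n [~ h, x i]) r
  (fun m n i mn => @hypercentral_leq m n _ mn) Hx.
exists n.+1 => y /=; have nZ := hypercentral_normal n.
have : generated [set x i | i in [set i | i < r]] y by rewrite gen.
apply: (generated_ind (P := [set y | hypercentral n [~ h, y]])) => /=.
- by move=> _ [i ir <-]; exact: Hn.
- by rewrite commg1; apply: (normal1 nZ).
- move=> u v Zu Zv; rewrite commgJM; apply: (normalM nZ); last exact: (normalJ nZ).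
  by rewrite commgV; apply/(normalV nZ)/(normalJ nZ).
Qed.

End NormalSubgroup.

(** * Greedy words in a strong system *)

Section Greedy.
Variables (G : groupType) (S Z : set G) (x : nat -> G) (r : nat).
Hypothesis sS : strong_system S.
Hypothesis SR : forall a b, S a -> S b -> S [~ a, b].
Hypothesis nZ : normal_subgroup Z.
Hypothesis Sx : forall i, i < r -> S (x i).
Hypothesis xZ : forall h, (forall i, i < r -> Z [~ h, x i]) -> Z h.

Lemma greedy_letter h : ~ Z h ->
  exists c, [/\ c < r, ~ Z [~ h, x c] & forall d, c < d < r -> Z [~ h, x d]].
Proof.
move=> nZh.
have ex : exists c, `[< c < r /\ ~ Z [~ h, x c] >].
  apply: contrapT => no; apply: nZh; apply: xZ => i ir; apply: contrapT => nZi.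
  by apply: no; exists i; apply/asboolP.
have bnd c : `[< c < r /\ ~ Z [~ h, x c] >] -> c <= r.
  by move=> /asboolP[cr _]; exact: ltnW.
case: (ex_maxnP ex bnd) => c /asboolP[cr nZc] cmax.
exists c; split=> // d /andP[cd dr]; apply: contrapT => nZd.
by have := cmax d (asboolT (conj dr nZd)); rewrite leqNgt cd.
Qed.

(** Starting outside [Z], one repeatedly takes the commutator with the generator
    of largest index that keeps the element outside [Z]. The indices form an
    infinite word [w]. *)
Lemma greedy_chain h : S h -> ~ Z h -> exists (g : nat -> G) (w : nat -> nat),
  forall n, [/\ S (g n), ~ Z (g n), w n < r, g n.+1 = [~ g n, x (w n)]
              & forall d, w n < d < r -> Z [~ g n, x d]].
Proof.
move=> Sh nZh.
have /choice[next nextP] k : exists c, ~ Z k ->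
    [/\ c < r, ~ Z [~ k, x c] & forall d, c < d < r -> Z [~ k, x d]].
  have [Zk|nZk] := pselect (Z k); first by exists 0.
  by have [c] := greedy_letter nZk; exists c.
pose g := fix g n := if n is m.+1 then [~ g m, x (next (g m))] else h.
have gP n : S (g n) /\ ~ Z (g n).
  elim: n => //= n [Sg nZg]; have [cr nZc _] := nextP _ nZg.
  by split=> //; apply: SR => //; apply: Sx.
exists g, (fun n => next (g n)) => n; have [Sg nZg] := gP n.
by have [] := nextP _ nZg; split.
Qed.

(** For a Lyndon word [f] let [p] be its iterated commutator along standard
    factorizations. The claim [bracket] says that commutation with [p] acts on
    the chain like the letters of [f] in turn where [f] is read in [w], and is
    trivial where [f] exceeds [w]: this follows from the Jacobi identity, because
    for [f = f' f''] the second factor exceeds [f] and thus also [w]. So a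
    window [u v u] of [w] would put a member of the chain into [Z], as a triple
    commutator [[~ [~ g, p], q]] commutes with [p]. *)
Lemma strong_system_sub_normal h : S h -> Z h.
Proof.
move=> Sh; apply: contrapT => nZh; have [g [w gw]] := greedy_chain Sh nZh.
have gS n : S (g n) by case: (gw n).
have bracket m : forall f, lyndon f m -> (forall s, s < m -> f s < r) ->
  exists2 p, S p & forall n,
    (agree f (shift n w) m -> cong Z [~ g n, p] (g (n + m)%N)) /\
    (forall k, k < m -> agree f (shift n w) k -> w (n + k)%N < f k -> Z [~ g n, p]).
  elim/ltn_ind: m => m IHm f Lf fr.
  have m0 : 0 < m by case: Lf.
  have [m1|m1] := leqP m 1.
    have em : m = 1%N by lia.
    subst m.
    exists (x (f 0)) => [|n]; first by apply/Sx/fr.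
    have [_ _ wr gS1 big] := gw n; split=> [fw|k k1 _ wf].
      by rewrite addn1 gS1 (fw 0) // /shift addn0; apply: cong_refl.
    have k0 : k = 0 by lia.
    by apply: big; move: wf; rewrite k0 addn0 => ->; apply: fr.
  have [k [km Lk Lk']] := lyndon_split m1 Lf.
  have [p Sp Hp] := IHm k ltac:(lia) f Lk (fun s sk => fr s ltac:(lia)).
  have [q Sq Hq] := IHm (m - k)%N ltac:(lia) (shift k f) Lk'
    (fun s sk => fr (k + s)%N ltac:(lia)).
  have [t [ktm ft ltt]] := Lf.2 k km.
  (* The suffix [f''] exceeds [f] at index [t], and [f] either agrees with [w] or
     exceeds it at index [j]; so [f''] exceeds [w] at the smaller of both. *)
  have Zq n j : j <= m -> agree f (shift n w) j -> j = m \/ w (n + j)%N < f j ->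
      Z [~ g n, q].
    move=> jm fw fj; have [tj|jt] := ltnP t j.
      apply: (proj2 (Hq n) t); first lia.
        by move=> s st; rewrite -(ft s st) fw //; lia.
      by have := fw t tj; rewrite /shift => <-.
    apply: (proj2 (Hq n) j); first lia.
      by move=> s sj; rewrite -(ft s) ?fw //; lia.
    have fkj : f j <= shift k f j.
      move: jt; rewrite leq_eqVlt => /predU1P[->|jt]; first exact: ltnW.
      by rewrite (ft j jt).
    case: fj => [|fj]; first lia.
    exact: leq_trans fj fkj.
  exists [~ p, q] => [|n]; first exact: SR.
  have jac : Z [~ g n, q] -> cong Z [~ g n, [~ p, q]] [~ [~ g n, p], q].
    exact: (strong_jacobi sS nZ (gS n) Sp Sq).
  split=> [fw|j jm fw wf].
    apply: (cong_trans nZ (jac (Zq n m (leqnn m) fw (or_introl erefl)))).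
    have fwk : agree f (shift n w) k by move=> s sk; apply: fw; lia.
    apply: (cong_trans nZ (congR nZ q (proj1 (Hp n) fwk))).
    have -> : (n + m = n + k + (m - k))%N by lia.
    by apply: (proj1 (Hq _)) => s sm; rewrite /shift fw /shift ?addnA //; lia.
  apply: (cong_in nZ (jac (Zq n j (ltnW jm) fw (or_intror wf)))).
  have [jk|kj] := ltnP j k; first exact/(normalRl nZ)/(proj2 (Hp n) j).
  have fwk : agree f (shift n w) k by move=> s sk; apply: fw; lia.
  apply: (cong_in nZ (congR nZ q (proj1 (Hp n) fwk))).
  apply: (proj2 (Hq _) (j - k)%N); first lia.
    by move=> s sm; rewrite /shift fw /shift ?addnA //; lia.
  rewrite /shift; have -> : (k + (j - k) = j)%N by lia.
  by have -> : (n + k + (j - k) = n + j)%N by lia.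
have wr i : w i < r by case: (gw i).
have [i [m [l [Lm Ll e]]]] := sandwich_unavoidable wr.
have [p Sp Hp] := bracket m _ Lm (fun s _ => wr _).
have gp := proj1 (Hp i) (fun s _ => erefl).
case: (gw (i + m + l + m)%N) => _ nZg _ _ _; apply: nZg.
apply: (cong_in nZ (cong_sym nZ (proj1 (Hp (i + m + l)%N) e))).
case: Ll => [l0|Ll].
  rewrite l0 addn0; apply: (cong_in nZ (cong_sym nZ (congR nZ p gp))).
  have -> : [~ [~ g i, p], p] = 1; last exact: (normal1 nZ).
  by apply/eqP/commgP/commute_sym/(strong_pair sS).
have [q Sq Hq] := bracket l _ Ll (fun s _ => wr _).
have gq := proj1 (Hq (i + m)%N) (fun s _ => erefl).
apply: (cong_in nZ (cong_sym nZ (congR nZ p gq))).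
apply: (cong_in nZ (cong_sym nZ (congR nZ p (congR nZ q gp)))).
have -> : [~ [~ [~ g i, p], q], p] = 1; last exact: (normal1 nZ).
by apply/eqP/commgP/commute_sym/(bracket3_comm2 sS).
Qed.

End Greedy.

(** * From strong sandwich sets to strong systems *)
Section Final.
Variable G : groupType.
Implicit Types (A H K X Y : set G) (a b c g h p q t v x y z : G).

Lemma generated_sub A : A `<=` generated A.
Proof. exact: sub_gen_smallest. Qed.

Lemma generated1 A : generated A 1.
Proof. by move=> H [[/set_mem H1 _] _]. Qed.

Lemma generatedF A x y : generated A x -> generated A y -> generated A (x / y).
Proof.
move=> Ax Ay H HA; have [[_ HB] _] := HA.
by apply/set_mem/HB; apply/mem_set; [exact: Ax|exact: Ay].
Qed.

Lemma generatedV A x : generated A x -> generated A x^-1.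
Proof. by move=> Ax; rewrite -div1g; apply: generatedF => //; apply: generated1. Qed.

Lemma generated_leq A B : A `<=` generated B -> generated A `<=` generated B.
Proof. by move=> AB; apply: generated_ind => //; [exact: generated1|exact: generatedF]. Qed.

Lemma lower_centralR n H x y :
  lower_central n H x -> H y -> lower_central n.+1 H [~ x, y].
Proof. by move=> Hx Hy; apply: generated_sub; exists x => //; exists y. Qed.

Lemma class2_commute H x a : nilpotent_class_le 2 H -> H x -> H a ->
  commute a [~ x, a].
Proof.
move=> cl Hx Ha; apply/commute_sym/commgP/eqP.
have : lower_central 2 H [~ [~ x, a], a] by do !apply: lower_centralR.
by rewrite cl.
Qed.

(** If [[~ c, y]] commutes with [y] and [a], then the conjugations of [c] by
    [y^-1] and by [y ^ a] cancel. *)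
Lemma commute_commg_of_central c y a : commute c a ->
  commute [~ c, y] y -> commute [~ c, y] a -> commute c [~ y, a].
Proof.
move=> ca ty ta; set t := [~ c, y] in ty ta.
have cyV : c ^ y^-1 = c * t^-1.
  apply: (@conjg_inj _ y); rewrite conjgKV conjMg conjVg.
  by rewrite (commute_conjgE ty) conjg_mulR mulgK.
have cya : c ^ (y ^ a) = c * t.
  have -> : c ^ (y ^ a) = ((c ^ a^-1) ^ y) ^ a by rewrite -!conjgM.
  rewrite (commute_conjgE (commuteV ca)) [c ^ y]conjg_mulR conjMg.
  by rewrite (commute_conjgE ca) (commute_conjgE ta).
have tya : t ^ (y ^ a) = t by apply: commute_conjgE; apply: commuteJ.
apply/commgP/conjg_fixP.
by rewrite {1}/commg conjgM cyV conjMg conjVg tya cya mulgK.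
Qed.

Lemma class3_commute H x y a : nilpotent_class_le 3 H -> H x -> H y -> H a ->
  commute a [~ x, a] -> commute [~ x, a] [~ y, a].
Proof.
move=> cl Hx Hy Ha ax.
have C3 v : H v -> commute [~ [~ x, a], y] v.
  move=> Hv; apply/commgP/eqP.
  have : lower_central 3 H [~ [~ [~ x, a], y], v] by do !apply: lower_centralR.
  by rewrite cl.
by apply: commute_commg_of_central; [exact: commute_sym|exact: C3|exact: C3].
Qed.

Definition symmetric_conjugates X : set G :=
  [set a | exists x g, X x /\ (a = x ^ g \/ a = x^-1 ^ g)].

(** The sandwich conditions allow two of the elements to be conjugated freely; a
    simultaneous conjugation, which commutators respect, frees the remaining one. *)
Lemma symmetric_conjugates_strong X : generated X = [set: G] ->
  strong_sandwich_set X -> strong_system (symmetric_conjugates X).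
Proof.
move=> gX [X2 X3].
have mem x g a A k : a = x ^ g \/ a = x^-1 ^ g -> A (x ^ (g * k)) ->
    generated A (a ^ k).
  move=> ax Ax; have {}Ax := generated_sub Ax.
  case: ax => ->; rewrite -conjgM //.
  by rewrite conjVg; apply: generatedV.
have any g : generated X g by rewrite gX.
have S0 a x : symmetric_conjugates X a -> symmetric_conjugates X x ->
    commute a [~ x, a].
  move=> [y [g [Xy ay]]] [z [k [Xz xz]]].
  apply/(commute_conj _ _ g^-1); rewrite conjRg.
  apply: (class2_commute (X2 _ _ (k * g^-1) Xy Xz (any _))).
    by apply: mem xz _; right.
  by apply: mem ay _; left; rewrite mulgV conjg1.
split=> //.
- move=> a g [x [k [Xx ax]]]; exists x, (k * g); split=> //.
  by rewrite !conjgM; case: ax => ->; [left|right].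
- move=> a [x [k [Xx ax]]]; exists x, k; split=> //.
  by case: ax => ->; rewrite -conjVg ?invgK; [right|left].
- move=> a x y Sa Sx Sy; have ax := S0 a x Sa Sx.
  move: Sa Sx Sy => [a0 [g [Xa aE]]] [x0 [k [Xx xE]]] [y0 [l [Xy yE]]].
  apply/(commute_conj _ _ g^-1); rewrite !conjRg.
  apply: (class3_commute
    (X3 _ _ _ (k * g^-1) (l * g^-1) Xa Xx Xy (any _) (any _))).
  + by apply: mem xE _; left; right.
  + by apply: mem yE _; right.
  + by apply: mem aE _; left; left; rewrite mulgV conjg1.
  + by rewrite -conjRg; apply/commute_conj.
Qed.

Lemma generated_finite_support X g : generated X g ->
  exists s : seq G, (forall x, x \in s -> X x) /\ generated [set` s] g.
Proof.
apply: (generated_ind (P := [set g | exists s : seq G,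
  (forall x, x \in s -> X x) /\ generated [set` s] g])) => /= [x Xx||x y].
- exists [:: x]; split=> [y|]; first by rewrite inE => /eqP ->.
  by apply: generated_sub; rewrite /= inE.
- by exists [::]; split=> //; apply: generated1.
- move=> [s [sX sx]] [u [uX uy]]; exists (s ++ u); split.
    by move=> z; rewrite mem_cat => /orP[/sX|/uX].
  have sub (A B : seq G) : {subset A <= B} ->
      generated [set` A] `<=` generated [set` B].
    by move=> AB; apply: generated_leq => z /AB zB; apply: generated_sub.
  apply: generatedF.
    by apply: sub sx => z zs; rewrite mem_cat zs.
  by apply: sub uy => z zu; rewrite mem_cat zu orbT.
Qed.

Lemma finite_generating_subset X : finitely_generated G ->
  generated X = [set: G] ->
  exists s : seq G, (forall x, x \in s -> X x) /\ generated [set` s] = [set: G].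
Proof.
move=> [Y [/finite_seqP[u ->] gY]] gX.
suff [s [sX us]] : exists s : seq G, (forall x, x \in s -> X x) /\
    forall y, y \in u -> generated [set` s] y.
  exists s; split=> //; apply/seteqP; split=> // g _.
  have : generated [set` u] g by rewrite gY.
  exact: (generated_leq us).
elim: (u) => [|y v [s [sX vs]]]; first by exists [::].
have [t [tX ty]] : exists t : seq G, (forall x, x \in t -> X x) /\
    generated [set` t] y by apply: generated_finite_support; rewrite gX.
have sub (A : seq G) : {subset A <= s ++ t} ->
    generated [set` A] `<=` generated [set` s ++ t].
  by move=> At; apply: generated_leq => z /At zB; apply: generated_sub.
exists (s ++ t); split=> [x|z].
  by rewrite mem_cat => /orP[/sX|/tX].
rewrite inE => /predU1P[->|/vs].
  by apply: sub ty => x xt; rewrite mem_cat xt orbT.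
by apply: sub => x xs; rewrite mem_cat xs.
Qed.

Lemma lower_central_hypercentral n k : (forall g, hypercentral n g) -> k <= n ->
  lower_central k [set: G] `<=` hypercentral (n - k).
Proof.
move=> hn; elim: k => [_ g _|k IHk kn]; first by rewrite subn0.
have nZ := @hypercentral_normal G (n - k.+1).
apply: generated_ind; [|exact: (normal1 nZ)|].
  move=> _ [x Lx [y _ <-]].
  by have := IHk (ltnW kn) x Lx; have -> : n - k = (n - k.+1).+1 by lia.
by move=> x y Zx Zy; apply: (normalM nZ) => //; apply: (normalV nZ).
Qed.

Lemma hypercentral_nilpotent n : (forall g, hypercentral n g) ->
  nilpotent_class_le n [set: G].
Proof.
move=> hn; apply/seteqP; split=> g.
  by move=> /(lower_central_hypercentral hn (leqnn n)); rewrite subnn.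
by move=> ->; case: n {hn} => // n; apply: generated1.
Qed.

End Final.

Theorem theorem1p1 (G : groupType) :
  finitely_generated G -> strong_sandwich_group G -> nilpotent [set: G].
Proof.
move=> fg [X [sX gX]].
have [s [sub_s gs]] := finite_generating_subset fg gX.
have strong := strong_brackets (symmetric_conjugates_strong gX sX).
pose x i := nth 1 s i.
have xE : [set x i | i in [set i | i < size s]] = [set` s].
  apply/seteqP; split=> g /=; first by move=> [i i_s <-]; apply: mem_nth.
  by move=> g_s; exists (index g s); [rewrite /= index_mem|exact: nth_index].
have gx : generated [set x i | i in [set i | i < size s]] = [set: G].
  by rewrite xE.
have xS i : i < size s -> brackets (symmetric_conjugates X) (x i).
  move=> i_s; apply: sub_brackets; exists (x i), 1.
  by split; [apply/sub_s/mem_nth|left; rewrite conjg1].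
have xZ i : i < size s -> hypercenter (x i).
  move=> i_s; apply: (strong_system_sub_normal strong _ (@hypercenter_normal G) xS) (xS i i_s).
    by move=> a b; apply: bracketsR.
  by move=> h; apply: hypercenter_gen.
have [n xn] := @common_level (fun n i => hypercentral n (x i)) (size s)
  (fun m n i mn => @hypercentral_leq G m n _ mn) xZ.
exists n; apply: hypercentral_nilpotent => g; have nZ := @hypercentral_normal G n.
have : generated [set x i | i in [set i | i < size s]] g by rewrite gx.
apply: generated_ind; [by move=> _ [i i_s <-]; exact: xn|exact: (normal1 nZ)|].
by move=> y z Zy Zz; apply: (normalM nZ) => //; apply: (normalV nZ).
Qed.
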